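(* Let $(a_n)\subseteq[0,1]$ be a sequence of reals and let $(X_n),(C_n)$ be nonnegative stochastic processes satisfying $$X_{n+1}\le(1-a_n)X_n+C_n$$ almost surely for all $n\in\mathbb{N}$. Suppose that (a) $\mathbb{E}[X_n]\le K$ for all $n\in\mathbb{N}$, where $K>0$; (b) $\sum_{i=0}^\infty a_i=\infty$ with rate of divergence $\theta$; (c) $\sum_{i=0}^\infty\mathbb{E}[C_i]<\infty$ with rate of convergence $\chi$. Then $\mathbb{E}[X_n]\to0$ with rate $$\varphi_{K,\theta,\chi}(\varepsilon):=\theta\left(\chi\left(\tfrac{\varepsilon}{2}\right),\ln\left(\tfrac{2K}{\varepsilon}\right)\right)+1,$$ and further $X_n\to0$ almost surely with rate $$\psi_{K,\theta,\chi}(\lambda,\varepsilon):=\varphi_{K,\theta,\chi}\left(\tfrac{\lambda\varepsilon}{2}\right).$$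
   Context: All random variables live on a fixed probability space $(\Omega,\mathcal{F},\mathbb{P})$; a stochastic process is a sequence of real-valued random variables indexed by $\mathbb{N}=\{0,1,2,\dots\}$. For nonnegative reals $(a_n)$: a rate for $a_n\to0$ is a function $\varphi:(0,\infty)\to\mathbb{N}$ with $a_n<\varepsilon$ for all $\varepsilon>0$ and $n\ge\varphi(\varepsilon)$. A rate of convergence for $\sum_{n=0}^\infty a_n<\infty$ is a function $\chi:(0,\infty)\to\mathbb{N}$ with $\sum_{n=\chi(\varepsilon)}^\infty a_n<\varepsilon$ for all $\varepsilon>0$. A rate of divergence for $\sum_{n=0}^\infty a_n=\infty$ is a function $\theta:\mathbb{N}\times(0,\infty)\to\mathbb{N}$ with $\sum_{n=k}^{\theta(k,b)}a_n\ge b$ for all $b>0$, $k\in\mathbb{N}$ (so $\theta(k,b)\ge k$); by convention $\theta(k,b):=k$ for $b\le0$. For nonnegative random variables $(X_n)$: a rate for $X_n\to0$ almost surely is a function $\Phi:(0,\infty)^2\to\mathbb{N}$ with $\mathbb{P}(\exists n\ge\Phi(\lambda,\varepsilon)\,(X_n\ge\varepsilon))<\lambda$ for all $\lambda,\varepsilon>0$. *)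

(* Defs.v *)
From mathcomp Require Import all_boot all_order all_algebra.
From mathcomp Require Import all_classical all_reals all_analysis.

Set Implicit Arguments.
Unset Strict Implicit.
Unset Printing Implicit Defensive.

Import Order.TTheory GRing.Theory Num.Theory.
Import numFieldNormedType.Exports.

Local Open Scope classical_set_scope.
Local Open Scope ring_scope.
Local Open Scope ereal_scope.

(* A function on (0, oo) is a total function on R of which only the values at
   positive arguments are constrained or used. Sequences of nonnegative reals
   that may be expectations live in \bar R, where 'E_P takes its values. *)

Definition rate_to0 (R : realType) (a : nat -> \bar R) (phi : R -> nat) : Prop :=
  forall eps : R, (0 < eps)%R ->
  forall n : nat, (phi eps <= n)%N -> a n < eps%:E.

Definition rate_of_convergence (R : realType) (a : nat -> \bar R)
    (chi : R -> nat) : Prop :=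
  forall eps : R, (0 < eps)%R -> \sum_(chi eps <= i <oo) a i < eps%:E.

(* The sum runs over k <= i <= theta k b, upper bound included. The second
   conjunct is the convention theta(k, b) := k for b <= 0. *)
Definition rate_of_divergence (R : realType) (a : nat -> R)
    (theta : nat -> R -> nat) : Prop :=
  (forall (k : nat) (b : R), (0 < b)%R ->
     (b <= \sum_(k <= i < (theta k b).+1) a i)%R) /\
  (forall (k : nat) (b : R), (b <= 0)%R -> theta k b = k).

Definition rate_as_to0 (d : measure_display) (T : measurableType d)
    (R : realType) (P : probability T R) (X : nat -> {RV P >-> R})
    (Phi : R -> R -> nat) : Prop :=
  forall lambda eps : R, (0 < lambda)%R -> (0 < eps)%R ->
  P [set w | exists n : nat, (Phi lambda eps <= n)%N /\ (eps <= X n w)%R]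
    < lambda%:E.

Definition phi_rate (R : realType) (K : R) (theta : nat -> R -> nat)
    (chi : R -> nat) (eps : R) : nat :=
  (theta (chi (eps / 2)%R) (ln (2 * K / eps)%R) + 1)%N.

Definition psi_rate (R : realType) (K : R) (theta : nat -> R -> nat)
    (chi : R -> nat) (lambda eps : R) : nat :=
  phi_rate K theta chi (lambda * eps / 2)%R.

(* Main.v *)
Require Import Defs.
From mathcomp Require Import all_boot all_order all_algebra.
From mathcomp Require Import all_classical all_reals all_analysis.
From mathcomp Require Import measurable_realfun.
From mathcomp Require Import ring lra.

Set Implicit Arguments.
Unset Strict Implicit.

Import Order.TTheory GRing.Theory Num.Theory.
Import numFieldNormedType.Exports.

Local Open Scope classical_set_scope.
Local Open Scope ring_scope.

(** Taking expectations turns the almost sure recursion into the deterministic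
one [x n.+1 <= (1 - a n) * x n + c n] for [x n := E(X n)] and [c n := E(C n)].
Unfolding it from [k] to [n], with [1 - t <= exp (- t)], gives

  [x n <= exp (- (a k + ... + a n.-1)) * x k + (c k + ... + c n.-1)]

([le_affine_recursion]). For [k := chi (eps / 2)] the second term is below
[eps / 2]; the rate of divergence is called with the value [ln (2K / eps)], for
which the exponential is at most [eps / 2K], so that the first term is at most
[eps / 2] as well. This is the rate for the expectations.

For the almost sure rate, convergence in mean has to be turned into a bound on
the whole future of the process. Since [1 - a n <= 1], the recursion also gives
[X n.+1 <= X n + C n], so almost surely the process never exceeds the random
variable [X M + C M + C M.+1 + ...] from time [M] on. Markov's inequality for that one variable
([maximal_inequality]) bounds the probability of ever reaching [eps] after [M]
by [(E(X M) + E(C M) + E(C M.+1) + ...) / eps]. For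
[M := phi (lambda * eps / 2)] the expectation of [X M] is below
[lambda * eps / 2]; and since [M >= chi (lambda * eps / 4)], by the form of
[phi], the sum of the expectations of [C] from [M] on is below
[lambda * eps / 4]. Hence the same index serves both purposes. The two limits
are then consequences of the two rates. *)

(** The discrete Gronwall bound: each earlier perturbation [c i] is only damped
further by later factors [1 - a j <= 1], so it is kept with weight one, while
the factors in front of [x k] are collected in the exponential. *)
Lemma le_affine_recursion (R : realType) (x a c : nat -> R) (k n : nat)
    (a01 : forall i, 0 <= a i <= 1) (x_ge0 : forall i, 0 <= x i)
    (c_ge0 : forall i, 0 <= c i)
    (x_rec : forall i, x i.+1 <= (1 - a i) * x i + c i) :
  (k <= n)%N ->
  x n <= expR (- \sum_(k <= i < n) a i) * x k + \sum_(k <= i < n) c i.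
Proof.
elim: n => [|n IHn].
  by rewrite leqn0 => /eqP ->; rewrite !big_geq// oppr0 expR0 mul1r addr0.
rewrite leq_eqVlt => /predU1P[<-|]; first
  by rewrite !big_geq// oppr0 expR0 mul1r addr0.
rewrite ltnS => kn; rewrite !big_nat_recr//= opprD expRD.
set S := \sum_(_ <= _ < _) a _ in IHn *.
set Q := \sum_(_ <= _ < _) c _ in IHn *.
have Q0 : 0 <= Q by exact: sumr_ge0.
have /andP[an0 an1] := a01 n.
have en : 1 - a n <= expR (- a n) by exact: expR_ge1Dx.
apply: (le_trans (x_rec n)); rewrite addrA lerD2r.
have eS0 : 0 <= expR (- S) * x k by rewrite mulr_ge0// expR_ge0.
apply: (@le_trans _ _ ((1 - a n) * (expR (- S) * x k + Q))).
  by rewrite ler_wpM2l ?subr_ge0// IHn.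
rewrite mulrDr lerD//.
  by rewrite mulrA [X in _ <= X * _]mulrC -!mulrA ler_wpM2r.
by rewrite ler_piMl// lerBlDr lerDl.
Qed.

(** For [b > 0] an empty sum cannot reach [b]. *)
Lemma rate_of_divergence_ge (R : realType) (a : nat -> R)
    (theta : nat -> R -> nat) (a_rate : rate_of_divergence a theta)
    (k : nat) (b : R) : (k <= theta k b)%N.
Proof.
have [pos nonpos] := a_rate; have [b0|b0] := lerP b 0; first by rewrite nonpos.
rewrite leqNgt; apply/negP => lt_k.
by have := pos k b b0; rewrite big_geq// leNgt b0.
Qed.

(** For [y <= 1], where [ln y <= 0] and the rate is [k] by convention, the bound
holds because the exponential is at most [1]. *)
Lemma expR_rate_of_divergence (R : realType) (a : nat -> R)
    (theta : nat -> R -> nat) (k n : nat) (y : R)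
    (a_ge0 : forall i, 0 <= a i) (a_rate : rate_of_divergence a theta) :
  0 < y -> (theta k (ln y) < n)%N -> expR (- \sum_(k <= i < n) a i) <= y^-1.
Proof.
move=> y0 ltn; rewrite expRN lef_pV2 ?posrE ?expR_gt0//.
rewrite -[leLHS](lnK y0) ler_expR.
have [b0|b0] := lerP (ln y) 0.
  by rewrite (le_trans b0)// sumr_ge0.
apply: (le_trans (a_rate.1 k _ b0)).
rewrite [leRHS](@big_cat_nat _ _ _ (theta k (ln y)).+1)//=.
  by rewrite lerDl sumr_ge0.
by rewrite leqW// (rate_of_divergence_ge a_rate).
Qed.

Lemma rate_to0_cvg (R : realType) (a : nat -> \bar R) (phi : R -> nat) :
  (forall n, 0 <= a n)%E -> rate_to0 a phi -> (a n @[n --> \oo] --> 0)%E.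
Proof.
move=> a_ge0 a_rate.
have fin e n : 0 < e -> (phi e <= n)%N -> a n \is a fin_num.
  by move=> e0 en; rewrite ge0_fin_numE// (lt_trans (a_rate e e0 n en)) ?ltry.
apply/fine_cvgP; split.
  by exists (phi 1) => // n /=; exact: fin.
apply/cvgr0Pnorm_lt => e e0; exists (phi e) => // n /= en.
rewrite ger0_norm ?fine_ge0// -lte_fin fineK ?(fin e)//.
exact: a_rate.
Qed.

Section RandomSequences.
Context {d : measure_display} {T : measurableType d} {R : realType}
  (P : probability T R).

(** Nonnegativity makes the expectation linear with values in the extended
reals, where an infinite expectation causes no cancellation. *)
Lemma expectation_affine_le (X Y Z : {RV P >-> R}) (r : R)
    (X_ge0 : forall w, 0 <= X w) (Y_ge0 : forall w, 0 <= Y w)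
    (Z_ge0 : forall w, 0 <= Z w) :
  0 <= r -> {ae P, forall w, Z w <= r * X w + Y w} ->
  ('E_P[Z] <= r%:E * 'E_P[X] + 'E_P[Y])%E.
Proof.
move=> r0 le_ae.
have mX : measurable_fun setT (fun w => (X w)%:E) by exact/measurable_EFinP.
have mY : measurable_fun setT (fun w => (Y w)%:E) by exact/measurable_EFinP.
have -> : (r%:E * 'E_P[X] + 'E_P[Y] = 'E_P[fun w => (r * X w + Y w)%R])%E.
  rewrite unlock -ge0_integralZl//; last by move=> w _; rewrite lee_fin.
  rewrite -ge0_integralD//.
  - by move=> w _; rewrite mule_ge0// lee_fin.
  - exact: measurable_funeM.
  - by move=> w _; rewrite lee_fin.
apply: expectation_le => //.
- by apply: measurable_funD => //; exact: measurable_funM.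
- by move=> w; rewrite addr_ge0// mulr_ge0.
Qed.

Lemma measurable_exists_ge (X : nat -> {RV P >-> R}) (N : nat) (eps : R) :
  measurable [set w | exists n, (N <= n)%N /\ eps <= X n w].
Proof.
rewrite (_ : [set w | _] = \bigcup_(n in [set n | N <= n]%N)
    (X n @^-1` `[eps, +oo[%classic)); last first.
  apply/seteqP; split => w /=.
    by move=> [n [Nn Xn]]; exists n => //=; rewrite in_itv/= Xn.
  by move=> [n /= Nn]; rewrite in_itv/= andbT => Xn; exists n.
by apply: bigcup_measurable => n _; exact: measurable_funPTI.
Qed.

(** Pathwise, for almost every [w], every [X n w] with [N <= n] lies below the
single random variable [V := X N + C N + C N.+1 + ...]: summing the one-step
bounds costs at most the whole tail of [C]. The exceptional set is a countable
union of null sets, so the event for all [n >= N] together is no likelier than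
[eps <= V], to which Markov's inequality applies; monotone convergence computes
the expectation of [V]. *)
Lemma maximal_inequality (X C : nat -> {RV P >-> R}) (N : nat) (eps : R)
    (X_ge0 : forall n w, 0 <= X n w) (C_ge0 : forall n w, 0 <= C n w)
    (X_rec : forall n, {ae P, forall w, X n.+1 w <= X n w + C n w}) :
  0 < eps ->
  (eps%:E * P [set w | exists n, (N <= n)%N /\ (eps <= X n w)%R]
     <= 'E_P[X N] + \sum_(N <= i <oo) 'E_P[C i])%E.
Proof.
move=> eps0.
have mX : measurable_fun setT (fun w => (X N w)%:E) by exact/measurable_EFinP.
have mC n : measurable_fun setT (fun w => (C (n + N)%N w)%:E).
  exact/measurable_EFinP.
pose S w := (\sum_(0 <= i <oo) (C (i + N)%N w)%:E)%E.
pose V w := ((X N w)%:E + S w)%E.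
have S_ge0 w : (0 <= S w)%E by apply: nneseries_ge0 => i _ _; rewrite lee_fin.
have V_ge0 w : (0 <= V w)%E by rewrite adde_ge0// lee_fin.
have mS : measurable_fun setT S.
  by apply: (ge0_emeasurable_sum (P := xpredT)) => // k w _ _; rewrite lee_fin.
have mV : measurable_fun setT V by exact: emeasurable_funD.
have <- : (\int[P]_w V w = 'E_P[X N] + \sum_(N <= i <oo) 'E_P[C i])%E.
  rewrite ge0_integralD//; last by move=> w _; rewrite lee_fin.
  rewrite integral_nneseries//; last by move=> n w _; rewrite lee_fin.
  rewrite -expectation_def -(@nneseries_addn _ (fun i => 'E_P[C i])%E);
    last first.
    by move=> i; exact: expectation_ge0.
  by congr (_ + _)%E; apply: eq_eseriesr => i _; rewrite -expectation_def.
have /ae_foralln[Z [mZ PZ0 subZ]] := X_rec.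
have X_le w m : ~ Z w -> ((X (m + N)%N w)%:E <= V w)%E.
  move=> Zw.
  have X_step i : X i.+1 w <= X i w + C i w.
    by apply: contrapT => h; apply: Zw; apply: subZ => /= /(_ i).
  apply: (@le_trans _ _
      ((X N w)%:E + \sum_(0 <= i < m) (C (i + N)%N w)%:E)%E).
    rewrite sumEFin -EFinD lee_fin; elim: m => [|m IHm].
      by rewrite big_geq// addr0.
    by rewrite big_nat_recr//= addrA (le_trans (X_step _))// lerD2r.
  by rewrite leeD2l// nneseries_lim_ge// => i _ _; rewrite lee_fin.
have := le_integral_abse P measurableT mV eps0.
under [in leRHS]eq_integral do rewrite gee0_abs//.
move=> markov; apply: (le_trans _ markov); rewrite lee_pmul2l//.
have mA : measurable ([set: T] `&` [set w | eps%:E <= `|V w|]%E).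
  by apply: emeasurable_fun_c_infty => //; exact: measurableT_comp.
rewrite -[leRHS]adde0 -PZ0; apply: (le_trans _ (measureU2 _ mA mZ)).
apply: le_measure; rewrite ?inE.
- exact: measurable_exists_ge.
- exact: measurableU.
move=> w /= [n [Nn Xn]]; have [Zw|Zw] := pselect (Z w); [by right|left].
split=> //; rewrite gee0_abs// -(subnK Nn) in Xn *.
by apply: le_trans (X_le w _ Zw); rewrite lee_fin; exact: Xn.
Qed.

(** If [X n w] does not tend to [0], then for some [e = 1 / k.+1] the values
[X n w] are at least [e] infinitely often. For fixed [e] this event is contained
in each of those controlled by the rate, so its probability is below every
[l > 0]; countably many [e] suffice. *)
Lemma rate_as_to0_cvg (X : nat -> {RV P >-> R}) (Phi : R -> R -> nat)
    (X_ge0 : forall n w, 0 <= X n w) :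
  rate_as_to0 X Phi -> {ae P, forall w, X n w @[n --> \oo] --> 0}.
Proof.
move=> X_rate.
pose B e := [set w | forall N, exists n, (N <= n)%N /\ e <= X n w].
have B_null e : 0 < e -> P.-negligible (B e).
  move=> e0.
  pose D := \bigcap_N [set w | exists n, (N <= n)%N /\ e <= X n w].
  have mD : measurable D.
    by apply: bigcapT_measurable => N; exact: measurable_exists_ge.
  have -> : B e = D.
    by apply/seteqP; split => w; [move=> h N _; exact: h|move=> h N; exact: h].
  apply/negligibleP => //; apply/eqP; rewrite eq_le measure_ge0 andbT.
  apply/lee_addgt0Pr => l l0; rewrite add0e.
  apply: le_trans (ltW (X_rate l e l0 e0)).
  apply: le_measure; rewrite ?inE//; first exact: measurable_exists_ge.
  by move=> w; exact.
have : P.-negligible (\bigcup_k B (k.+1%:R^-1)).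
  by apply: negligible_bigcup => k; apply: B_null; rewrite invr_gt0.
apply: negligibleS => w /= Xw; apply: contrapT => notB; apply: Xw.
apply/cvgr0Pnorm_lt => e e0.
have [k ke] : exists k, k.+1%:R^-1 < e.
  have [k _ /(_ k (leqnn _)) ke] := near_infty_natSinv_lt (PosNum e0).
  by exists k.
have /existsNP[N HN] : ~ B k.+1%:R^-1 w by move=> h; apply: notB; exists k.
exists N => // n /= Nn; rewrite ger0_norm// (lt_trans _ ke)// ltNge.
by apply/negP => h; apply: HN; exists n.
Qed.

End RandomSequences.

Theorem lemma2p4 (d : measure_display) (T : measurableType d) (R : realType)
    (P : probability T R)
    (a : nat -> R) (X C : nat -> {RV P >-> R})
    (K : R) (theta : nat -> R -> nat) (chi : R -> nat)
    (a01 : forall n : nat, 0 <= a n <= 1)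
    (X_ge0 : forall (n : nat) (w : T), 0 <= X n w)
    (C_ge0 : forall (n : nat) (w : T), 0 <= C n w)
    (X_rec : forall n : nat,
      {ae P, forall w : T, X n.+1 w <= (1 - a n) * X n w + C n w})
    (K_gt0 : 0 < K)
    (EX_le : forall n : nat, ('E_P[X n] <= K%:E)%E)
    (a_div : (\sum_(0 <= i <oo) (a i)%:E = +oo)%E)
    (a_rate : rate_of_divergence a theta)
    (C_cvg : (\sum_(0 <= i <oo) 'E_P[C i] < +oo)%E)
    (C_rate : rate_of_convergence (fun i : nat => 'E_P[C i])%E chi) :
  (('E_P[X n] @[n --> \oo] --> 0)%E /\
   rate_to0 (fun n : nat => 'E_P[X n])%E (phi_rate K theta chi)) /\
  ({ae P, forall w : T, X n w @[n --> \oo] --> 0} /\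
   rate_as_to0 X (psi_rate K theta chi)).
Proof.
have EX_ge0 n : (0 <= 'E_P[X n])%E by exact: expectation_ge0.
have EC_ge0 n : (0 <= 'E_P[C n])%E by exact: expectation_ge0.
have EX_fin n : 'E_P[X n]%E \is a fin_num.
  by rewrite ge0_fin_numE// (le_lt_trans (EX_le n)) ?ltry.
have EC_fin n : 'E_P[C n]%E \is a fin_num.
  rewrite ge0_fin_numE// (le_lt_trans _ C_cvg)//.
  apply: (@le_trans _ _ (\sum_(0 <= i < n.+1) 'E_P[C i])%E).
    by rewrite big_nat_recr//= leeDr// sume_ge0.
  exact: nneseries_lim_ge.
pose x n := fine 'E_P[X n]%E; pose c n := fine 'E_P[C n]%E.
have x_rec n : x n.+1 <= (1 - a n) * x n + c n.
  rewrite -lee_fin EFinD EFinM !fineK//.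
  by apply: expectation_affine_le => //; rewrite subr_ge0; case/andP: (a01 n).
have EX_rate : rate_to0 (fun n => 'E_P[X n])%E (phi_rate K theta chi).
  move=> eps eps0 n; rewrite /phi_rate addn1.
  set N := chi _ => thn.
  have eps2 : 0 < eps / 2 by rewrite divr_gt0.
  have Nn : (N <= n)%N.
    exact: leq_trans (rate_of_divergence_ge a_rate _ _) (ltnW thn).
  have c_lt : \sum_(N <= i < n) c i < eps / 2.
    rewrite -lte_fin -sumEFin; under eq_bigr do rewrite fineK//.
    by rewrite (le_lt_trans _ (C_rate _ eps2))// nneseries_lim_ge.
  have xN_le : x N <= K by rewrite -lee_fin fineK.
  have [x0 c0] : (forall i, 0 <= x i) /\ (forall i, 0 <= c i).
    by split => i; exact: fine_ge0.
  rewrite -(fineK (EX_fin n)) lte_fin.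
  apply: (le_lt_trans (le_affine_recursion a01 x0 c0 x_rec Nn)).
  have y0 : 0 < 2 * K / eps by rewrite divr_gt0// mulr_gt0.
  have := expR_rate_of_divergence (fun i => (andP (a01 i)).1) a_rate y0 thn.
  move=> e_le; rewrite (splitr eps) ler_ltD//.
  apply: (@le_trans _ _ ((2 * K / eps)^-1 * K)).
    by rewrite ler_pM// expR_ge0.
  by rewrite le_eqVlt; apply/orP; left; apply/eqP; field; rewrite !gt_eqF.
have X_rec1 n : {ae P, forall w, X n.+1 w <= X n w + C n w}.
  apply: filterS (X_rec n) => w /le_trans; apply; rewrite lerD2r.
  have /andP[an0 _] := a01 n.
  by rewrite ler_piMl// lerBlDr lerDl.
have X_rate : rate_as_to0 X (psi_rate K theta chi).
  move=> l e l0 e0; rewrite /psi_rate; set M := phi_rate _ _ _ _.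
  have h0 : 0 < l * e / 2 by rewrite divr_gt0// mulr_gt0.
  have tail_lt : (\sum_(M <= i <oo) 'E_P[C i] < (l * e / 2)%:E)%E.
    have NM : (chi (l * e / 2 / 2)%R <= M)%N.
      by rewrite /M /phi_rate addn1 leqW// (rate_of_divergence_ge a_rate).
    have := C_rate _ (divr_gt0 h0 (ltr0Sn _ 1)).
    rewrite (nneseries_split _ (M - chi (l * e / 2 / 2)))//.
    rewrite subnKC// => /(le_lt_trans _) h.
    apply: (@lt_trans _ _ (l * e / 2 / 2)%:E); last by rewrite lte_fin; lra.
    by apply: h; rewrite leeDr// sume_ge0.
  rewrite -(@lte_pmul2l _ e%:E)// -EFinM.
  apply: (le_lt_trans (maximal_inequality M X_ge0 C_ge0 X_rec1 e0)).
  rewrite (_ : e * l = l * e / 2 + l * e / 2); last by field.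
  by rewrite EFinD lteD// EX_rate.
split; split => //; first exact: rate_to0_cvg EX_rate.
exact: rate_as_to0_cvg X_rate.
Qed.
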